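(* Let $0 \le r_1 < r_2 \le n/2$ be integers, let $B = \bigcup_{i=r_1}^{r_2} S(n,i)$, and let $A$ be the adjacency matrix of the subgraph of the Hamming cube $\{0,1\}^n$ induced by $B$. For $0 \le t \le r_2$ write $t^* = \max\{t, r_1\}$ and let $\Lambda_t$ be the set of eigenvalues of the matrix $M_t$ defined below. Then: (1) For each $t = 0,\dots,r_2$ and each of the $r_2 - t^* + 1$ distinct real numbers $\lambda \in \Lambda_t$, the matrix $A$ has an eigenspace $W_t(\lambda)$ (a subspace of eigenvectors with eigenvalue $\lambda$) of dimension $\binom{n}{t} - \binom{n}{t-1}$. (2) Let $f \in W_t(\lambda)$. Then for each $i$ with $t^* \le i \le r_2$, the restriction of $f$ to $S(n,i)$ lies in the $t$-th eigenspace $V_t$ of $S(n,i)$. Furthermore, $f$ vanishes on $\bigcup_{i=0}^{t^*-1} S(n,i) \cap B$. The restrictions of functions in $W_t(\lambda)$ to $S(n,t^* )$ span the $t$-th eigenspace $V_t$ of $S(n,t^* )$, and a function $f \in W_t(\lambda)$ is determined by its restriction to $S(n,t^* )$. (3) A real number $\lambda$ is an eigenvalue of $A$ if and only if $\lambda \in \bigcup_{t=0}^{r_2}\Lambda_t$, and its multiplicity is $m(\lambda) = \sum_{t : \lambda \in \Lambda_t}\left(\binom{n}{t}-\binom{n}{t-1}\right)$, with $\binom{n}{-1}:=0$.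
   Context: $\{0,1\}^n$ is the Hamming cube (vertices adjacent iff Hamming distance $1$); points are identified with subsets of $\{1,\dots,n\}$ and $|x|$ is the weight. $S(n,i)=\{x:|x|=i\}$ with inner product $\langle f,g\rangle=\sum_{x\in S(n,i)}f(x)g(x)$. For $|z|\le i$, $g_z$ on $S(n,i)$ is $1$ at $x$ if $z\subseteq x$ and $0$ otherwise; $U_j=\mathrm{span}\{g_z:|z|\le j\}$; the eigenspaces of $S(n,i)$ are $V_0=U_0$ (constants) and $V_j=U_j\cap U_{j-1}^\perp$ for $1\le j\le i$. For $0\le t\le r_2$, $M_t$ is the symmetric tridiagonal $(r_2-t^*+1)\times(r_2-t^*+1)$ matrix with zero diagonal and off-diagonal entries (in order) $\sqrt{\lambda_{t^*-t+2}}, \sqrt{\lambda_{t^*-t+3}},\dots,\sqrt{\lambda_{r_2-t+1}}$, where $\lambda_k=(k-1)(n-2t-k+2)$; if $r_2=t^*$ it is the $1\times 1$ zero matrix. These off-diagonal entries are positive, so $M_t$ has $r_2-t^*+1$ distinct real eigenvalues. *)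

(* Defs.v *)
From HB Require Import structures.
From mathcomp Require Import all_boot all_order all_algebra.
Set Implicit Arguments. Unset Strict Implicit. Unset Printing Implicit Defensive.
Import Order.TTheory GRing.Theory Num.Theory.
Local Open Scope ring_scope.

(* Points of {0,1}^n are subsets of 'I_n; the weight is the cardinality. *)

Definition cube_adj n (x y : {set 'I_n}) : bool :=
  #|(x :\: y) :|: (y :\: x)| == 1%N.

Definition level n i : {set {set 'I_n}} := [set x : {set 'I_n} | #|x| == i].

Definition Bset n r1 r2 : {set {set 'I_n}} :=
  [set x : {set 'I_n} | (r1 <= #|x| <= r2)%N].

Definition Bpt n r1 r2 (i : 'I_#|Bset n r1 r2|) : {set 'I_n} := enum_val i.

Section WithR.
Variable R : rcfType.

Definition adjA n r1 r2 : 'M[R]_#|Bset n r1 r2| :=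
  \matrix_(i, j) (cube_adj (Bpt i) (Bpt j))%:R.

(* A (row) vector indexed by B viewed as a function on {0,1}^n
   (extended by 0 outside B). *)
Definition vfun n r1 r2 (f : 'rV[R]_#|Bset n r1 r2|) (x : {set 'I_n}) : R :=
  \sum_(i < #|Bset n r1 r2|) (Bpt i == x)%:R * f 0 i.

Definition gz n (z x : {set 'I_n}) : R := (z \subset x)%:R.

(* h (restricted to S(n,i)) lies in U_j = span{g_z : |z| <= j} (g_z defined
   for |z| <= i). *)
Definition inU n (i j : nat) (h : {set 'I_n} -> R) : Prop :=
  exists c : {set 'I_n} -> R, forall x, x \in level n i ->
    h x = \sum_(z : {set 'I_n} | (#|z| <= j)%N && (#|z| <= i)%N) c z * gz z x.

Definition orthU n (i j : nat) (h : {set 'I_n} -> R) : Prop :=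
  forall z : {set 'I_n}, (#|z| <= j)%N -> (#|z| <= i)%N ->
    \sum_(x in level n i) h x * gz z x = 0.

Definition inV n (i t : nat) (h : {set 'I_n} -> R) : Prop :=
  inU i t h /\ (if t is t'.+1 then orthU i t' h else True).

Definition lam (n t k : nat) : R :=
  (k.-1)%:R * (n%:R - 2%:R * t%:R - k%:R + 2%:R).

Definition Mt (n r1 r2 t : nat) : 'M[R]_((r2 - maxn t r1).+1) :=
  \matrix_(i, j)
    (if (j == i.+1 :> nat) then Num.sqrt (lam n t (maxn t r1 - t + 2 + i)%N)
     else if (i == j.+1 :> nat) then Num.sqrt (lam n t (maxn t r1 - t + 2 + j)%N)
     else 0).

End WithR.

Definition dimV n t : nat := ('C(n, t) - (if t is t'.+1 then 'C(n, t') else 0))%N.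

(* Main.v *)
(* For [v] on the [t]-subsets put [(E v)(y) = sum of v(z) over the t-subsets z of y].
   If [v] is killed by the down operator, then at a point [y] the function [E v]
   is multiplied by [|y| - t] under the up operator and by [n - |y| - t] under
   the down operator, so [A] acts on the functions [c(|y|) (E v)(y)] through a
   tridiagonal recurrence on [c], which a diagonal rescaling turns into [M_t].
   On each level these [E v] are pairwise orthogonal for distinct [t] and, by
   induction along the levels, they span everything; since [A] is symmetric,
   the components of an eigenvector are eigenvectors.  Hence the eigenspace of
   [A] is the orthogonal sum of the [W_t(lambda)], and its dimension is the
   algebraic multiplicity, again by symmetry. *)
Require Import Defs.
From HB Require Import structures.
From mathcomp Require Import all_boot all_order all_algebra.
From mathcomp Require Import ring lra zify.
Set Implicit Arguments. Unset Strict Implicit. Unset Printing Implicit Defensive.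
Import Order.TTheory GRing.Theory Num.Theory.
Local Open Scope ring_scope.

(** * Characteristic polynomials and eigenspaces of symmetric matrices *)

Lemma row_dot_eq0 (R : realDomainType) m (y : 'rV[R]_m) : y *m y^T = 0 -> y = 0.
Proof.
move=> /rowP /(_ 0); rewrite !mxE.
under eq_bigr do rewrite mxE -expr2.
move/psumr_eq0P => H; apply/rowP => i; rewrite mxE.
by apply/eqP; rewrite -sqrf_eq0 H // => j _; apply: sqr_ge0.
Qed.

(** The sizes [p] and [m] are kept apart because [p] will be a sum of two ranks; once they are
    identified, [P] is invertible and its determinant cancels. *)
Lemma char_poly_similar (F : fieldType) m p (P : 'M[F]_(p, m)) (A : 'M_m) (T : 'M_p) :
  p = m -> row_free P -> P *m A = T *m P -> char_poly A = char_poly T.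
Proof.
move=> epm; case: m / epm P A => P A.
rewrite row_free_unit unitmxE unitfE => Pn0 PA.
have: map_mx polyC P *m char_poly_mx A = char_poly_mx T *m map_mx polyC P.
  by rewrite /char_poly_mx mulmxBl mulmxBr -!map_mxM PA scalar_mxC.
move/(congr1 determinant); rewrite !det_mulmx mulrC.
by apply: mulIf; rewrite det_map_mx polyC_eq0.
Qed.

(* In a basis adapted to the eigenspace and its orthogonal complement, [A] is
   block diagonal, and [a] is not an eigenvalue of the second block. *)
Lemma mup_char_poly_sym (R : realFieldType) m (A : 'M[R]_m) (a : R) :
  A^T = A -> mup a (char_poly A) = \rank (eigenspace A a).
Proof.
move=> symA; set E := row_base (eigenspace A a).
set K := kermx E^T; set F := row_base K.
have EA : E *m A = a *: E by apply/eigenspaceP; rewrite eq_row_base.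
have FE : F *m E^T = 0 by apply/sub_kermxP; rewrite eq_row_base.
have /submxP [B FA] : (F *m A <= F)%MS.
  rewrite eq_row_base; apply/sub_kermxP.
  have -> : F *m A *m E^T = F *m (E *m A)^T by rewrite (trmx_mul E A) symA mulmxA.
  by rewrite EA linearZ /= -scalemxAr FE scaler0.
have Ffree : row_free F by apply: row_base_free.
have Efree : row_free E by apply: row_base_free.
have rK : (\rank (eigenspace A a) + \rank K = m)%N.
  have -> : \rank K = (m - \rank E^T)%N by rewrite /K mxrank_ker.
  by rewrite mxrank_tr (eqnP Efree) subnKC // rank_leq_row.
have perp0 (y : 'rV_m) : (y <= E)%MS -> (y <= F)%MS -> y = 0.
  case/submxP=> u ->; case/submxP => w Euw; apply: row_dot_eq0.
  by rewrite {1}Euw trmx_mul -mulmxA [F *m _]mulmxA FE mul0mx mulmx0.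
have PA : col_mx E F *m A = block_mx (a%:M) 0 0 B *m col_mx E F.
  by rewrite mul_col_mx mul_block_col !mul0mx addr0 add0r EA FA mul_scalar_mx.
have Pfree : row_free (col_mx E F).
  apply: inj_row_free => v; rewrite -[v]hsubmxK mul_row_col => /eqP.
  rewrite addr_eq0 => /eqP Ev.
  have E0 : lsubmx v *m E = 0.
    by apply: perp0; [exact: submxMl | rewrite Ev -mulNmx submxMl].
  have F0 : rsubmx v *m F = 0 by apply/eqP; rewrite -oppr_eq0 -Ev E0.
  rewrite -(mul0mx _ E) in E0; rewrite -(mul0mx _ F) in F0.
  by rewrite (row_free_inj Efree E0) (row_free_inj Ffree F0) row_mx0.
rewrite (char_poly_similar rK Pfree PA) /char_poly.
rewrite char_block_diag_mx det_ublock mulrC mupMr; last first.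
  (* A left eigenvector [v] of [B] for [a] would put [v *m F] both in the eigenspace and in its
     orthogonal complement, hence make it zero. *)
  rewrite -/(char_poly B) -eigenvalue_root_char; apply/negP.
  case/eigenvalueP => v vB vn0.
  have y0 : v *m F = 0.
    apply: perp0; last exact: submxMl.
    rewrite eq_row_base; apply/eigenspaceP.
    by rewrite -mulmxA FA mulmxA vB scalemxAl.
  rewrite -(mul0mx _ F) in y0.
  by move: vn0; rewrite (row_free_inj Ffree y0) eqxx.
rewrite -[\det _]/(char_poly _) char_poly_trig ?scalar_mx_is_trig //.
under eq_bigr do rewrite mxE eqxx mulr1n.
by rewrite prodr_const mup_XsubCX eqxx card_ord.
Qed.

(** * Inclusion sums and harmonic functions on the cube *)

Section InclusionSums.
Variables (R : rcfType) (n : nat).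
Implicit Types (t i : nat) (u v f g h : {set 'I_n} -> R) (w x y z : {set 'I_n}).

Definition incl_sum t v y : R := \sum_(z : {set 'I_n} | (#|z| == t) && (z \subset y)) v z.

(** This is the kernel of the down operator on level [t]; at [t = 0] the condition is vacuous and
    every [v] qualifies. *)
Definition harmonic t v : Prop :=
  forall w, #|w|.+1 = t -> \sum_(a | a \notin w) v (a |: w) = 0.

Lemma sum_setU1 (a : 'I_n) (P : pred {set 'I_n}) v :
  \sum_(z : {set 'I_n} | (a \in z) && P z) v z
  = \sum_(w : {set 'I_n} | (a \notin w) && P (a |: w)) v (a |: w).
Proof.
rewrite (reindex_onto (fun w => a |: w) (fun z => z :\ a)) => [|z /andP[az _]]; last exact: setD1K.
apply: eq_bigl => w; rewrite setU11 /= andbC.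
case: (boolP (a \in w)) => aw; last by rewrite setU1K ?eqxx.
by apply/negP => /andP[/eqP Ew _]; rewrite -Ew setD11 in aw.
Qed.

Lemma incl_sum_small t v y : (#|y| < t)%N -> incl_sum t v y = 0.
Proof.
move=> yt; rewrite /incl_sum big_pred0 // => z; apply/negP => /andP[/eqP zt /subset_leq_card].
by rewrite zt leqNgt yt.
Qed.

Lemma incl_sum_level t v z : #|z| = t -> incl_sum t v z = v z.
Proof.
move=> zt; rewrite /incl_sum (big_pred1 z) // => y /=.
apply/andP/eqP => [[/eqP yt yz]|->]; last by rewrite zt eqxx subxx.
by apply/eqP; rewrite eqEcard yz yt zt leqnn.
Qed.

Lemma eq_incl_sum t v v' y : (forall z, #|z| = t -> v z = v' z) ->
  incl_sum t v y = incl_sum t v' y.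
Proof. by move=> vv; apply: eq_bigr => z /andP[/eqP zt _]; apply: vv. Qed.

(** Double counting: a [t]-subset [z] of [y] survives the removal of [a] exactly when [a] lies
    outside [z]. *)
Lemma incl_sum_up t v y :
  \sum_(a in y) incl_sum t v (y :\ a) = (#|y|%:R - t%:R) * incl_sum t v y.
Proof.
rewrite /incl_sum (exchange_big_dep (fun z => (#|z| == t) && (z \subset y))) /=; last first.
  by move=> a z _; rewrite subsetD1 => /and3P[-> ->].
rewrite mulr_sumr; apply: eq_bigr => z /andP[/eqP zt zy].
rewrite (eq_bigl (fun a => a \in y :\: z)) => [|a].
  rewrite sumr_const cardsDS // -[LHS]mulr_natl natrB ?subset_leq_card //.
  by rewrite zt.
by rewrite subsetD1 zt eqxx zy inE andbC.
Qed.

(** Each [t]-subset of [y] is reached once for each of its [t] elements. *)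
Lemma incl_sum_cover t v y :
  \sum_(w : {set 'I_n} | (#|w|.+1 == t) && (w \subset y))
     \sum_(a in y | a \notin w) v (a |: w) = t%:R * incl_sum t v y.
Proof.
rewrite (exchange_big_dep (fun a => a \in y)) /=; last by move=> w a _ /andP[].
transitivity (\sum_(a in y) \sum_(z : {set 'I_n} | (a \in z) && ((#|z| == t) && (z \subset y))) v z).
  apply: eq_bigr => a ay; rewrite sum_setU1; apply: eq_bigl => w.
  rewrite ay subUset sub1set ay cardsU1 /=.
  by case: (a \in w); rewrite /= ?andbF ?andbT.
rewrite (exchange_big_dep (fun z => (#|z| == t) && (z \subset y))) /=; last first.
  by move=> a z _ /andP[].
rewrite mulr_sumr; apply: eq_bigr => z /andP[/eqP zt zy].
rewrite (eq_bigl (fun a => a \in z)) ?sumr_const ?zt ?mulr_natl // => a.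
by rewrite eqxx zy !andbT; apply/andP/idP => [[]//|az]; split=> //; apply: (subsetP zy).
Qed.

(** The [t]-subsets of [a |: y] either lie in [y], which accounts for [n - #|y|], or contain [a].
    For the latter, harmonicity trades the sum over [a] outside [y] for minus the sum over [a]
    inside [y], evaluated by [incl_sum_cover]. *)
Lemma incl_sum_down t v y : harmonic t v ->
  \sum_(a | a \notin y) incl_sum t v (a |: y)
  = (n%:R - #|y|%:R - t%:R) * incl_sum t v y.
Proof.
move=> hv; rewrite mulrBl -incl_sum_cover.
have -> : \sum_(a | a \notin y) incl_sum t v (a |: y) =
  \sum_(a | a \notin y) incl_sum t v y +
  \sum_(a | a \notin y) \sum_(w : {set 'I_n} | (#|w|.+1 == t) && (w \subset y)) v (a |: w).
  rewrite -big_split /=; apply: eq_bigr => a ay.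
  rewrite /incl_sum (bigID (fun z => a \in z)) /= addrC; congr (_ + _).
    apply: eq_bigl => z; rewrite -andbA; congr (_ && _).
    apply/andP/idP => [[zy az]|zy].
      by rewrite -(setU1K ay) subsetD1 zy az.
    by split; [rewrite (subset_trans zy) ?subsetUr | apply: contra ay => /(subsetP zy)].
  rewrite (eq_bigl (fun z => (a \in z) && ((#|z| == t) && (z \subset a |: y)))); last first.
    by move=> z; rewrite andbC.
  rewrite sum_setU1; apply: eq_bigl => w.
  rewrite cardsU1; case: (boolP (a \in w)) => aw /=.
    suff /negPf -> : ~~ (w \subset y) by rewrite andbF.
    by apply: contra ay => /subsetP; apply.
  by rewrite -{2}(setU1K ay) subsetD1 aw andbT subUset subsetUl.
rewrite sumr_const -[X in X + _ = _]mulr_natl; congr (_ * _ + _).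
  rewrite -cardsE (_ : [set a | _] = ~: y); last by apply/setP => a; rewrite !inE.
  by rewrite cardsCs setCK card_ord natrB // -[X in (_ <= X)%N]card_ord max_card.
rewrite exchange_big -sumrN; apply: eq_bigr => w /andP[/eqP wt wy] /=.
apply/eqP; rewrite -addr_eq0 -[X in _ == X](hv w wt) (bigID (mem y) (fun a => a \notin w)) /= addrC.
apply/eqP; congr (_ + _); apply: eq_bigl => a; last by rewrite andbC.
by case: (boolP (a \in y)) => ay; rewrite ?andbF // andbT; apply/esym/(contra _ ay)/(subsetP wy).
Qed.

Lemma sum_cube_adj f y :
  \sum_x (cube_adj x y)%:R * f x
  = \sum_(a in y) f (y :\ a) + \sum_(a | a \notin y) f (a |: y).
Proof.
pose flip a := if a \in y then y :\ a else a |: y.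
have adjE x : (cube_adj x y)%:R = \sum_a (x == flip a)%:R :> R.
  have E a : (x == flip a) = ((x :\: y) :|: (y :\: x) == [set a]).
    apply/eqP/eqP => [->|/setP E]; apply/setP => c; last move: (E c);
      rewrite /flip; case: ifP => ay; rewrite !inE; case: (eqVneq c a) => [->|_] /=;
      rewrite ?ay //=; by case: (_ \in x); case: (_ \in y).
  under eq_bigr do rewrite E.
  rewrite /cube_adj; case: cards1P => [[b ->]|N].
    rewrite (bigD1 b) //= eqxx big1 ?addr0 // => a ab.
    by rewrite (inj_eq set1_inj) eq_sym (negPf ab).
  by rewrite big1 // => a _; case: eqP => // E'; case: N; exists a.
under eq_bigr do rewrite adjE mulr_suml.
rewrite exchange_big /= (bigID (mem y)) /=.
have F a : \sum_x (x == flip a)%:R * f x = f (flip a).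
  rewrite (bigD1 (flip a)) //= eqxx mul1r big1 ?addr0 // => x /negPf ->.
  by rewrite mul0r.
by congr (_ + _); apply: eq_bigr => a ay; rewrite F /flip ?ay ?(negPf ay).
Qed.

Lemma sum_supersets h i z :
  \sum_(a | a \notin z) \sum_(x : {set 'I_n} | (#|x| == i) && (a |: z \subset x)) h x
  = (i%:R - #|z|%:R) * \sum_(x : {set 'I_n} | (#|x| == i) && (z \subset x)) h x.
Proof.
rewrite (exchange_big_dep (fun x => (#|x| == i) && (z \subset x))) /=; last first.
  by move=> a x _; rewrite subUset => /and3P[-> _ ->].
rewrite mulr_sumr; apply: eq_bigr => x /andP[/eqP xi zx].
rewrite (eq_bigl (fun a => a \in x :\: z)) => [|a].
  rewrite sumr_const cardsDS // -[LHS]mulr_natl natrB ?subset_leq_card //.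
  by rewrite xi.
by rewrite subUset sub1set xi eqxx zx inE andbT.
Qed.

(* Downward induction on [#|z|]: summing the left-hand side over the covers
   [a |: z] of [z] multiplies it by [i - #|z|], while [incl_sum_down] does
   the same to the right-hand side up to another scalar. *)
Lemma incl_sum_supersets t v i d : harmonic t v ->
  exists c : R, forall z, (#|z| + d)%N = i ->
    \sum_(x : {set 'I_n} | (#|x| == i) && (z \subset x)) incl_sum t v x = c * incl_sum t v z.
Proof.
move=> hv; elim: d => [|d [c IH]].
  exists 1 => z; rewrite addn0 mul1r => zi.
  rewrite (big_pred1 z) // => x /=; apply/andP/eqP => [[/eqP xi zx]|->].
    by apply/esym/eqP; rewrite eqEcard zx xi zi leqnn.
  by rewrite zi eqxx subxx.
exists (c * (n%:R - (i%:R - d.+1%:R) - t%:R) / d.+1%:R) => z zi.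
have d0 : d.+1%:R != 0 :> R by rewrite pnatr_eq0.
apply: (mulfI d0).
have <- : i%:R - #|z|%:R = d.+1%:R :> R by rewrite -zi natrD; ring.
rewrite -sum_supersets.
rewrite (eq_bigr (fun a => c * incl_sum t v (a |: z))) => [|a az].
  rewrite -mulr_sumr incl_sum_down // -zi natrD.
  by move: (d.+1%:R) d0 => D D0; field; rewrite addrAC subrr add0r.
by apply: IH; rewrite cardsU1 az; lia.
Qed.

(** By [incl_sum_supersets] the inner product is a multiple of [incl_sum t v z], an empty sum when
    [#|z| < t]. *)
Lemma incl_sum_orth_gz t v i z : harmonic t v -> (#|z| < t)%N ->
  \sum_(x in level n i) incl_sum t v x * gz R z x = 0.
Proof.
move=> hv zt; case: (leqP #|z| i) => [zi|iz]; last first.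
  apply: big1 => x; rewrite inE => /eqP xi; rewrite /gz.
  case: (boolP (z \subset x)) => [/subset_leq_card|_]; last by rewrite mulr0.
  by rewrite xi leqNgt iz.
have [c Hc] := incl_sum_supersets i (i - #|z|) hv.
transitivity (\sum_(x : {set 'I_n} | (#|x| == i) && (z \subset x)) incl_sum t v x).
  rewrite big_mkcondr; apply: eq_big => x; first by rewrite inE.
  by move=> _; rewrite /gz; case: ifP; rewrite ?mulr1 ?mulr0.
by rewrite Hc ?subnKC // incl_sum_small ?mulr0.
Qed.

Definition dot i f g : R := \sum_(x in level n i) f x * g x.

Lemma dotC i f g : dot i f g = dot i g f.
Proof. by apply: eq_bigr => x _; rewrite mulrC. Qed.

Lemma dot_eq0 i f : dot i f f = 0 -> forall x, #|x| = i -> f x = 0.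
Proof.
move=> H x xi; apply/eqP; rewrite -sqrf_eq0 expr2.
apply/eqP; apply: (psumr_eq0P _ H) => [y _|]; first by rewrite -expr2 sqr_ge0.
by rewrite inE xi.
Qed.

Lemma dot_sumr i f (I : finType) (P : pred I) (F : I -> {set 'I_n} -> R) :
  dot i f (fun x => \sum_(j | P j) F j x) = \sum_(j | P j) dot i f (F j).
Proof. by rewrite exchange_big; apply: eq_bigr => x _; rewrite mulr_sumr. Qed.

Lemma eq_dot i f f' g g' : (forall x, #|x| = i -> f x = f' x) ->
  (forall x, #|x| = i -> g x = g' x) -> dot i f g = dot i f' g'.
Proof.
by move=> ff gg; apply: eq_bigr => x; rewrite inE => /eqP xi; rewrite ff ?gg.
Qed.

Lemma incl_sum_gz s v x :
  incl_sum s v x = \sum_(z : {set 'I_n} | #|z| == s) v z * gz R z x.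
Proof.
rewrite /incl_sum big_mkcondr; apply: eq_bigr => z _.
by rewrite /gz; case: ifP; rewrite ?mulr1 ?mulr0.
Qed.

Lemma incl_sum_orth i s t v u : harmonic t v -> (s < t)%N ->
  dot i (incl_sum t v) (incl_sum s u) = 0.
Proof.
move=> hv st; rewrite /dot.
under eq_bigr do rewrite (incl_sum_gz s) mulr_sumr.
rewrite exchange_big big1 //= => z /eqP zs.
under eq_bigr do rewrite mulrCA.
by rewrite -mulr_sumr incl_sum_orth_gz ?zs ?mulr0.
Qed.

Lemma incl_sum_orth_neq i s t v u : harmonic t v -> harmonic s u -> s != t ->
  dot i (incl_sum t v) (incl_sum s u) = 0.
Proof.
move=> hv hu; rewrite neq_ltn => /orP[st|ts]; first exact: incl_sum_orth.
by rewrite dotC incl_sum_orth.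
Qed.

(** Vanishing descends one level at a time: the down operator multiplies by [n - #|x| - t], which is
    positive below level [i] because [i + t <= n]. On level [t] the inclusion sum is [v] itself. *)
Lemma incl_sum_inj t i v : harmonic t v -> (t <= i)%N -> (i + t <= n)%N ->
  (forall x, #|x| = i -> incl_sum t v x = 0) -> forall z, #|z| = t -> v z = 0.
Proof.
move=> hv /subnKC <-; elim: (i - t)%N => [|d IH] in_n Hi z zt.
  by rewrite -(incl_sum_level v zt) Hi // addn0.
apply: IH => // [|x xt]; first by lia.
have := incl_sum_down x hv; rewrite big1 => [|a ax]; last first.
  by apply: Hi; rewrite cardsU1 ax xt; lia.
move/esym/eqP; rewrite mulf_eq0 => /orP[/eqP|/eqP //] H; exfalso.
have : #|x|%:R + t%:R + 1 <= n%:R :> R.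
  by rewrite -natrD natr1 ler_nat xt; lia.
by lra.
Qed.

End InclusionSums.

(** * Functions on a finite set as row vectors *)

Section FunctionVectors.
Variables (R : rcfType) (T : finType).
Implicit Types (S : {set T}).

(** The analogue of [vfun] for any set of points, so that levels are covered as well; on [Bset] the
    two are convertible. *)
Definition fvec S (v : 'rV[R]_#|S|) (x : T) : R :=
  \sum_(i < #|S|) (enum_val i == x)%:R * v 0 i.

Definition rvec S (f : T -> R) : 'rV[R]_#|S| := \row_i f (enum_val i).

Definition opmx S1 S2 (k : T -> T -> R) : 'M[R]_(#|S1|, #|S2|) :=
  \matrix_(i, j) k (enum_val i) (enum_val j).

Lemma fvec_enum_val S (v : 'rV_#|S|) i : fvec v (enum_val i) = v 0 i.
Proof.
rewrite /fvec (bigD1 i) //= eqxx mul1r big1 ?addr0 // => j /negPf ij.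
by rewrite (inj_eq enum_val_inj) ij mul0r.
Qed.

Lemma fvec_out S (v : 'rV_#|S|) x : x \notin S -> fvec v x = 0.
Proof.
move=> xS; apply: big1 => i _; case: eqP => [ix|]; last by rewrite mul0r.
by rewrite -ix enum_valP in xS.
Qed.

Lemma enum_val_surj S x : x \in S -> exists i : 'I_#|S|, x = enum_val i.
Proof. by move=> xS; exists (enum_rank_in xS x); rewrite enum_rankK_in. Qed.

Lemma fvec_inj S (v w : 'rV_#|S|) : (forall x, x \in S -> fvec v x = fvec w x) -> v = w.
Proof. by move=> H; apply/rowP => i; rewrite -!fvec_enum_val H ?enum_valP. Qed.

Lemma fvec_rvec S f x : x \in S -> fvec (rvec S f) x = f x.
Proof. by case/enum_val_surj => i ->; rewrite fvec_enum_val mxE. Qed.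

Lemma fvecZ S a (v : 'rV_#|S|) x : fvec (a *: v) x = a * fvec v x.
Proof. by rewrite /fvec mulr_sumr; apply: eq_bigr => i _; rewrite mxE mulrCA. Qed.

Lemma fvec0 S x : fvec (0 : 'rV_#|S|) x = 0.
Proof. by apply: big1 => i _; rewrite mxE mulr0. Qed.

Lemma fvecB S (v w : 'rV_#|S|) x : fvec (v - w) x = fvec v x - fvec w x.
Proof. by rewrite /fvec -sumrB; apply: eq_bigr => i _; rewrite !mxE mulrBr. Qed.

Lemma fvec_sum S (I : finType) (P : pred I) (F : I -> 'rV_#|S|) x :
  fvec (\sum_(j | P j) F j) x = \sum_(j | P j) fvec (F j) x.
Proof.
by rewrite exchange_big; apply: eq_bigr => i _; rewrite summxE mulr_sumr.
Qed.

Lemma fvec_opmx S1 S2 k (v : 'rV_#|S1|) y : y \in S2 ->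
  fvec (v *m opmx S1 S2 k) y = \sum_(x in S1) fvec v x * k x y.
Proof.
case/enum_val_surj => j ->; rewrite fvec_enum_val mxE [RHS]big_enum_val.
by apply: eq_bigr => i _; rewrite fvec_enum_val mxE.
Qed.

Lemma trmx_opmx S1 S2 k : (opmx S1 S2 k)^T = opmx S2 S1 (fun x y => k y x).
Proof. by apply/matrixP => i j; rewrite !mxE. Qed.

End FunctionVectors.

(* [u *m M^T] is the orthogonal projection of [h] onto the row space of [M^T]. *)
Lemma orth_kermx_decomp (R : realFieldType) p q (M : 'M[R]_(p, q)) (h : 'rV_p) :
  exists u : 'rV_q, (h - u *m M^T) *m M = 0.
Proof.
(* If [v = x *m M^T] and [v *m M = 0], then [v *m v^T = 0]; so [M] is injective on the row space of
   [M^T]. *)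
have rMtM : \rank (M^T *m M) = \rank M^T.
  apply/mxrank_injP/eqP/eqP/rowV0P => v; rewrite sub_capmx => /andP[/submxP[x vx] /sub_kermxP vM].
  by apply: row_dot_eq0; rewrite {2}vx trmx_mul trmxK mulmxA vM mul0mx.
have MtM : (M <= M^T *m M)%MS.
  by rewrite -(mxrank_leqif_sup (submxMl _ _)) rMtM mxrank_tr.
have /submxP [u hu] : (h *m M <= M^T *m M)%MS by apply: submx_trans MtM; apply: submxMl.
by exists u; rewrite mulmxBl hu mulmxA subrr.
Qed.

(** * Harmonic decomposition of the functions on a level *)

Section Harmonic.
Variables (R : rcfType) (n : nat).
Implicit Types (t i : nat) (u v f g h : {set 'I_n} -> R) (w x y z : {set 'I_n}).

(* Empty for [t = 0]. *)
Definition level_pred t : {set {set 'I_n}} := [set w : {set 'I_n} | #|w|.+1 == t].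

Definition downmx t : 'M[R]_(#|level n t|, #|level_pred t|) :=
  opmx (level n t) (level_pred t) (fun z w => (w \subset z)%:R).

Lemma sum_covers f w :
  \sum_(z : {set 'I_n} | (#|z| == #|w|.+1) && (w \subset z)) f z
  = \sum_(a | a \notin w) f (a |: w).
Proof.
have := sum_supersets f #|w|.+1 w.
rewrite -[_.+1%:R]natr1 addrAC subrr add0r mul1r => <-.
apply: eq_bigr => a aw; rewrite (big_pred1 (a |: w)) // => x /=.
have cE : #|a |: w| = #|w|.+1 by rewrite cardsU1 aw.
apply/andP/eqP => [[/eqP xi zx]|->]; last by rewrite cE eqxx subxx.
by apply/esym/eqP; rewrite eqEcard zx xi cE leqnn.
Qed.

Lemma card_setD1 i (a : 'I_n) x : a \in x -> #|x| = i.+1 -> #|x :\ a| = i.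
Proof. by move=> ax; rewrite (cardsD1 a) ax => -[]. Qed.

Lemma incl_sum_pred i f x : #|x| = i.+1 -> incl_sum i f x = \sum_(a in x) f (x :\ a).
Proof.
move=> xi; have := incl_sum_up i f x.
rewrite xi -[_.+1%:R]natr1 addrAC subrr add0r mul1r => <-.
by apply: eq_bigr => a ax; rewrite incl_sum_level // (card_setD1 ax xi).
Qed.

Lemma harmonicP t (v : 'rV_#|level n t|) : harmonic t (fvec v) <-> v *m downmx t = 0.
Proof.
have E w : #|w|.+1 = t ->
    fvec (v *m downmx t) w = \sum_(a | a \notin w) fvec v (a |: w).
  move=> wt; rewrite fvec_opmx ?inE ?wt // -sum_covers wt [RHS]big_mkcondr.
  apply: eq_big => z; first by rewrite inE.
  by case: (w \subset z); rewrite ?mulr1 ?mulr0.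
split=> [hv|v0 w wt]; last by rewrite -E // v0 fvec0.
by apply: fvec_inj => w; rewrite inE fvec0 => /eqP wt; rewrite E // hv.
Qed.

Lemma eq_harmonic t v v' : (forall z, #|z| = t -> v z = v' z) ->
  harmonic t v -> harmonic t v'.
Proof.
move=> E hv w wt; rewrite -[RHS](hv w wt); apply: eq_bigr => a aw.
by rewrite E // -wt cardsU1 aw.
Qed.

Lemma harmonicZ t (c : R) v : harmonic t v -> harmonic t (fun z => c * v z).
Proof. by move=> hv w wt; rewrite -mulr_sumr hv ?mulr0. Qed.

Lemma incl_sumZ t (c : R) v y : incl_sum t (fun z => c * v z) y = c * incl_sum t v y.
Proof. by rewrite /incl_sum mulr_sumr. Qed.

(** Induction on the level: [h] is a function killed by the down operator plus the up operator
    applied to some [u] one level below. By [incl_sum_up], going up only multiplies the degree [t]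
    component of [u] by [i + 1 - t]. *)
Lemma harmonic_decomp i h : exists v : nat -> {set 'I_n} -> R,
  (forall t, harmonic t (v t)) /\
  forall x, #|x| = i -> h x = \sum_(t < i.+1) incl_sum t (v t) x.
Proof.
elim: i h => [|i IH] h.
  exists (fun t => if t is 0%N then h else fun=> 0); split=> [[|t] //= w _|x x0].
    by rewrite big1.
  by rewrite big_ord1 /= incl_sum_level.
have [u hu] := orth_kermx_decomp (downmx i.+1) (rvec _ h).
set v0 := rvec _ h - _ in hu; have hv0 := (harmonicP _).2 hu.
have [v [hv Ev]] := IH (fvec u).
exists (fun t => if t == i.+1 then fvec v0 else fun z => (i.+1%:R - t%:R) * v t z).
split=> [t|x xi]; first by case: eqP => [->|_] //; apply: harmonicZ.
rewrite big_ord_recr /= eqxx incl_sum_level // fvecB fvec_rvec ?inE ?xi //.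
rewrite addrC -[LHS](subrK (fvec (u *m (downmx i.+1)^T) x)); congr (_ + _).
rewrite trmx_opmx fvec_opmx ?inE ?xi //.
transitivity (incl_sum i (fvec u) x).
  rewrite /incl_sum big_mkcondr; apply: eq_big => w; first by rewrite inE eqSS.
  by case: (w \subset x); rewrite ?mulr1 ?mulr0.
rewrite incl_sum_pred //.
under [LHS]eq_bigr => a ax.
  rewrite Ev; last exact: card_setD1 ax xi.
  over.
rewrite exchange_big; apply: eq_bigr => t _ /=.
by rewrite incl_sum_up xi (ltn_eqF (ltn_ord t)) incl_sumZ.
Qed.

(* On the component of degree [t] of [f], "up then down" is multiplication by
   [(i + 1 - t) * (n - i - t)], which is positive when [2 * i < n]. *)
Lemma up_inj i f : (2 * i < n)%N -> (forall x, #|x| = i.+1 -> incl_sum i f x = 0) ->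
  forall w, #|w| = i -> f w = 0.
Proof.
move=> i2n f0; have [v [hv Ev]] := harmonic_decomp i f.
have DU w : #|w| = i -> \sum_(t < i.+1)
    (i.+1%:R - t%:R) * (n%:R - i%:R - t%:R) * incl_sum t (v t) w = 0.
  move=> wi; transitivity (\sum_(a | a \notin w) incl_sum i f (a |: w)); last first.
    by apply: big1 => a aw; rewrite f0 // cardsU1 aw wi.
  have U x : #|x| = i.+1 ->
      incl_sum i f x = \sum_(t < i.+1) (i.+1%:R - t%:R) * incl_sum t (v t) x.
    move=> xi; rewrite incl_sum_pred //.
    under [LHS]eq_bigr => a ax.
      rewrite Ev; last exact: card_setD1 ax xi.
      over.
    by rewrite exchange_big; apply: eq_bigr => t _; rewrite /= incl_sum_up xi.
  under [RHS]eq_bigr => a aw do rewrite U ?cardsU1 ?aw ?wi //.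
  rewrite exchange_big; apply: eq_bigr => t _ /=.
  by rewrite -mulr_sumr incl_sum_down // wi mulrA.
move=> w wi; rewrite Ev // big1 // => s _.
(* Pairing [DU] with the component of degree [s] removes the other degrees by orthogonality and
   leaves [c] times its squared norm. *)
apply: (dot_eq0 _ wi).
pose c := (i.+1%:R - s%:R) * (n%:R - i%:R - s%:R) : R.
have c0 : c != 0.
  have s1 : s%:R + 1 <= i.+1%:R :> R by rewrite natr1 ler_nat.
  have s2 : i%:R + s%:R + 1 <= n%:R :> R.
    by rewrite -natrD natr1 ler_nat; have := ltn_ord s; lia.
  by rewrite mulf_neq0 // gt_eqF //; lra.
apply: (mulfI c0); rewrite mulr0.
transitivity (dot i (incl_sum s (v s)) (fun x => \sum_(t < i.+1)
    (i.+1%:R - t%:R) * (n%:R - i%:R - t%:R) * incl_sum t (v t) x)); last first.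
  by apply: big1 => x; rewrite inE => /eqP xi; rewrite DU ?mulr0.
have dotZ t (b : R) : dot i (incl_sum s (v s)) (fun x => b * incl_sum t (v t) x)
    = b * dot i (incl_sum s (v s)) (incl_sum t (v t)).
  by rewrite /dot mulr_sumr; apply: eq_bigr => x _; rewrite mulrCA.
rewrite dot_sumr (bigD1 s) //= big1 ?addr0 ?dotZ // => t ts.
by rewrite dotZ incl_sum_orth_neq ?mulr0.
Qed.

Lemma card_level t : #|level n t| = 'C(n, t).
Proof. by rewrite card_draws card_ord. Qed.

(** The transpose of the down operator is the up operator from level [t - 1], injective by [up_inj];
    hence [downmx] has full column rank. *)
Lemma rank_harmonic t : (2 * t <= n)%N -> \rank (kermx (downmx t)) = dimV n t.
Proof.
move=> tn; have -> : \rank (kermx (downmx t)) = (#|level n t| - #|level_pred t|)%N.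
  rewrite mxrank_ker -mxrank_tr; congr (_ - _)%N; apply/eqnP.
  apply: inj_row_free => u; rewrite trmx_opmx => u0.
  apply: fvec_inj => w; rewrite inE fvec0 => /eqP wt.
  apply: (@up_inj #|w|) => [|x xw|//]; first by lia.
  rewrite wt in xw.
  have /(congr1 (fun r : 'rV_#|level n t| => fvec r x)) := u0; rewrite fvec_opmx ?inE ?xw // fvec0 => <-.
  rewrite /incl_sum big_mkcondr; apply: eq_big => z; first by rewrite inE -wt eqSS.
  by case: (z \subset x); rewrite ?mulr1 ?mulr0.
rewrite card_level /dimV; congr (_ - _)%N; case: t tn => [|t] tn.
  by apply/eqP; rewrite cards_eq0; apply/eqP/setP => w; rewrite !inE.
by rewrite -card_level; apply: eq_card => w; rewrite !inE eqSS.
Qed.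

(** Consecutive binomials have ratio [(n - t) / (t + 1) > 1] here. Hence a single [t] with [lambda]
    in its spectrum makes the eigenspace nonzero. *)
Lemma dimV_gt0 t : (2 * t <= n)%N -> (0 < dimV n t)%N.
Proof.
case: t => [|t] tn; first by rewrite /dimV bin0.
rewrite /dimV subn_gt0; have := mul_bin_left n t.
have : (0 < 'C(n, t))%N by rewrite bin_gt0; lia.
move: 'C(n, t) 'C(n, t.+1) => b c; nia.
Qed.

End Harmonic.

(** * The tridiagonal recurrence *)

Section Jacobi.
Variables (R : rcfType) (n r1 r2 t : nat) (lambda : R).
Hypotheses (r2n : (2 * r2 <= n)%N) (r12 : (r1 < r2)%N) (tr2 : (t <= r2)%N).
Implicit Types (c d : nat -> R).

Local Notation ts := (maxn t r1).

(* Solutions are extended by 0 outside of the levels [ts..r2]. *)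
Definition radial_sol c : Prop :=
  (forall i, ~~ (ts <= i <= r2)%N -> c i = 0) /\
  (forall i, (ts <= i <= r2)%N ->
     lambda * c i = (i%:R - t%:R) * c i.-1 + (n%:R - i%:R - t%:R) * c i.+1).

Lemma radial_sol_comb c d (a b : R) : radial_sol c -> radial_sol d ->
  radial_sol (fun i => a * c i + b * d i).
Proof.
move=> [c0 Ec] [d0 Ed]; split=> i Hi; first by rewrite c0 ?d0 // !mulr0 addr0.
by rewrite mulrDr mulrCA Ec // (mulrCA lambda b) Ed //; ring.
Qed.

Lemma down_coef_gt0 i : (i < r2)%N -> 0 < n%:R - i%:R - t%:R :> R.
Proof.
move=> ir; rewrite -addrA -opprD subr_gt0 -natrD ltr_nat; lia.
Qed.

(** The coefficient of [c i.+1] is positive for [i < r2], so the recurrence can be solved upward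
    from its value at [ts]. *)
Lemma radial_sol0 c : radial_sol c -> c ts = 0 -> forall i, c i = 0.
Proof.
move=> [c0 Ec] cs0 i.
have next j : (ts <= j)%N -> c j = 0 -> (j%:R - t%:R) * c j.-1 = 0 -> c j.+1 = 0.
  move=> sj cj cj1; case: (ltnP j r2) => [jr|rj]; last by apply: c0; lia.
  have := Ec j; rewrite sj ltnW // cj cj1 mulr0 add0r => /(_ isT)/esym/eqP.
  by rewrite mulf_eq0 (gt_eqF (down_coef_gt0 jr)) => /eqP.
case: (leqP ts i) => [/subnKC <-|si]; last by apply: c0; lia.
suff : c (ts + (i - ts))%N = 0 /\ c (ts + (i - ts)).+1 = 0 by case.
elim: (i - ts)%N => [|k [k1 k2]]; rewrite ?addn0 ?addnS; split=> //.
  (* At the bottom level the term in [c ts.-1] drops out: either [ts = t] and its coefficient is 0,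
     or [ts = r1 > t] and [ts.-1] is outside the support. *)
  apply: next => //; case: (eqVneq ts t) => [->|ne]; first by rewrite subrr mul0r.
  by rewrite c0 ?mulr0 //; lia.
by apply: next => //=; [lia | rewrite k1 mulr0].
Qed.

Lemma radial_sol_unique c d : radial_sol c -> radial_sol d -> c ts = 1 ->
  forall i, d i = c i * d ts.
Proof.
move=> sc sd cs i; apply/eqP; rewrite -subr_eq0; apply/eqP.
have sol := radial_sol_comb 1 (- d ts) sd sc.
by have := radial_sol0 sol; rewrite cs mul1r mulr1 subrr => /(_ erefl i) <-; ring.
Qed.

Let m := (r2 - ts)%N.
Let sq l := Num.sqrt (lam R n t (ts - t + 2 + l)%N).
(* [c (ts + j) = g j * e j] turns the recurrence into the equation [e *m M_t = lambda *: e]. *)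
Let g j := \prod_(l < j) ((ts + l.+1 - t)%:R / sq l).

(** The right-hand side is the product of the two recurrence coefficients linking levels [ts + l]
    and [ts + l + 1]; symmetrising replaces both by its square root. *)
Let lamE l : lam R n t (ts - t + 2 + l)%N = (ts + l.+1 - t)%:R * (n%:R - (ts + l)%:R - t%:R).
Proof.
rewrite /lam; have -> : ((ts - t + 2 + l).-1 = ts + l.+1 - t)%N by lia.
congr (_ * _).
have -> : (ts - t + 2 + l)%:R = ts%:R - t%:R + 2 + l%:R :> R.
  by rewrite !natrD natrB ?leq_maxl.
by rewrite natrD; ring.
Qed.

Let coef_gt0 l : 0 < (ts + l.+1 - t)%:R :> R.
Proof. by rewrite ltr0n; lia. Qed.

Let sq_gt0 l : (l < m)%N -> 0 < sq l.
Proof.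
move=> lm; rewrite sqrtr_gt0 lamE mulr_gt0 ?coef_gt0 // down_coef_gt0 //.
by rewrite /m in lm; lia.
Qed.

Let g_gt0 j : (j <= m)%N -> 0 < g j.
Proof.
move=> jm; apply: prodr_gt0 => l _; rewrite divr_gt0 ?coef_gt0 ?sq_gt0 //.
exact: leq_trans jm.
Qed.

Let g_sq j : (j < m)%N -> g j.+1 * sq j = (ts + j.+1 - t)%:R * g j.
Proof.
move=> jm; rewrite /g big_ord_recr /= -mulrA divfK ?gt_eqF ?sq_gt0 // mulrC.
by [].
Qed.

Let sq_g j : (j < m)%N -> g j * sq j = (n%:R - (ts + j)%:R - t%:R) * g j.+1.
Proof.
move=> jm; have s0 : sq j != 0 by rewrite gt_eqF ?sq_gt0.
apply: (mulIf s0); rewrite -[RHS]mulrA g_sq // -mulrA -expr2 sqr_sqrtr; last first.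
  by apply: ltW; rewrite -sqrtr_gt0; exact: sq_gt0.
by rewrite lamE; ring.
Qed.

(** Letting [e] run over all naturals and vanish past [m] makes the last column read like the
    others; only the first needs its own case. *)
Let Mt_mulE (e : nat -> R) (j : 'I_m.+1) : (forall k, (m < k)%N -> e k = 0) ->
  ((\row_(k < m.+1) e k) *m Mt R n r1 r2 t) 0 j
  = (if (j : nat) is j'.+1 then sq j' * e j' else 0) + sq j * e j.+1.
Proof.
move=> e0; rewrite mxE.
have -> : \sum_k (\row_(k < m.+1) e k) 0 k * Mt R n r1 r2 t k j =
  \sum_(k < m.+1) (if j == k.+1 :> nat then sq k * e k else 0) +
  \sum_(k < m.+1) (if k == j.+1 :> nat then sq j * e k else 0).
  rewrite -big_split; apply: eq_bigr => k _ /=; rewrite !mxE.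
  case: (eqVneq (j : nat) k.+1) => [jk|_].
    by rewrite ltn_eqF ?addr0 1?[LHS]mulrC // jk ltnS leqnSn.
  by case: ifP => _; rewrite ?mulr0 add0r // mulrC.
congr (_ + _); last first.
  rewrite -big_mkcond (big_ord1_eq _ (fun k => sq j * e k)) /=.
  by case: ltnP => [_|jm]; rewrite ?addr0 // e0 ?mulr0.
case: j => -[|j] jm /=; first by rewrite big1.
rewrite -big_mkcond /= (eq_bigl (fun k : 'I_m.+1 => k == j :> nat)) => [|k]; last first.
  by rewrite eqSS eq_sym.
by rewrite (big_ord1_eq _ (fun k => sq k * e k)) ltnW // addr0.
Qed.

(** Eigenvectors and radial solutions correspond through the rescaling by [g]; the normalisation is
    possible because a nonzero solution is nonzero at [ts] by [radial_sol0]. *)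
Lemma eigenvalue_MtP :
  eigenvalue (Mt R n r1 r2 t) lambda <-> exists2 c, radial_sol c & c ts = 1.
Proof.
split.
  case/eigenvalueP => e0 Ee e0n0.
  pose e k := if insub k is Some i then e0 0 i else 0 : R.
  have eE : e0 = \row_(k < m.+1) e k by apply/rowP => i; rewrite mxE /e valK.
  have esupp k : (m < k)%N -> e k = 0 by move=> mk; rewrite /e insubF //; lia.
  pose c i := if (ts <= i)%N then g (i - ts) * e (i - ts)%N else 0.
  have sc : radial_sol c.
    split=> i Hi.
      rewrite /c; case: ifP => // si; rewrite esupp ?mulr0 // /m; lia.
    have im : (i - ts < m.+1)%N by rewrite /m; lia.
    have := congr1 (fun v : 'rV_m.+1 => v 0 (Ordinal im)) Ee.
    rewrite {1}eE Mt_mulE // !mxE {1}eE mxE /= => Ei.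
    have [si ir] := andP Hi.
    rewrite /c si (leq_trans si (leqnSn i)) (subSn si) mulrCA -Ei mulrDr; congr (_ + _).
      case: (ltnP ts i) => [si1|is_].
        have -> : (ts <= i.-1)%N by lia.
        have Ej : (i - ts = (i.-1 - ts).+1)%N by lia.
        rewrite {1 2}Ej mulrA g_sq; last by rewrite /m; lia.
        rewrite -mulrA; congr (_ * _).
        have -> : (ts + (i.-1 - ts).+1 = i)%N by lia.
        by rewrite natrB //; lia.
      have -> : (i - ts = 0)%N by lia.
      rewrite mulr0; case: (eqVneq i t) => [->|it]; first by rewrite subrr mul0r.
      by rewrite ifF ?mulr0 //; apply/negP; lia.
    case: (ltnP (i - ts) m) => jm.
      by rewrite mulrA sq_g // -mulrA subnKC.
    by rewrite esupp ?mulr0 // ltnS.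
  case: (eqVneq (c ts) 0) => [cs0|csn0].
    case/eqP: e0n0; apply/rowP => j; rewrite eE !mxE.
    have := radial_sol0 sc cs0 (ts + j); rewrite /c leq_addr addKn => /eqP.
    by rewrite mulf_eq0 gt_eqF ?g_gt0 ?leq_ord // => /eqP.
  exists (fun i => (c ts)^-1 * c i + 0 * c i); first exact: radial_sol_comb.
  by rewrite mulVf // mul0r addr0.
case=> c [c0 Ec] cs; apply/eigenvalueP.
pose e k := c (ts + k)%N / g k.
have esupp k : (m < k)%N -> e k = 0 by move=> mk; rewrite /e c0 ?mul0r //; rewrite /m in mk; lia.
exists (\row_(k < m.+1) e k); last first.
  apply/eqP => /rowP/(_ ord0); rewrite !mxE /e addn0 cs /g big_ord0 => /eqP.
  by rewrite divr1 oner_eq0.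
apply/rowP => j; rewrite Mt_mulE // !mxE.
have gek k : (k <= m)%N -> g k * e k = c (ts + k)%N.
  by move=> km; rewrite /e mulrC divfK // gt_eqF ?g_gt0.
have gj : g j != 0 by rewrite gt_eqF ?g_gt0 ?leq_ord.
apply: (mulfI gj); rewrite [RHS]mulrCA gek ?leq_ord // Ec; last first.
  by have := leq_ord j; rewrite /m; lia.
rewrite mulrDr; congr (_ + _).
  case: j {gj} => -[|j] jm /=.
    rewrite mulr0 addn0; case: (eqVneq ts t) => [->|ne]; first by rewrite subrr mul0r.
    by rewrite c0 ?mulr0 //; lia.
  rewrite mulrA g_sq // -mulrA gek; last exact: ltnW.
  rewrite addnS.
  by congr (_ * _); rewrite natrB //; lia.
case: (ltnP j m) => jm; last by rewrite esupp ?mulr0 // c0 ?mulr0 //; rewrite /m in jm; lia.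
by rewrite mulrA sq_g // -mulrA gek ?addnS.
Qed.

End Jacobi.

(** * Eigenspaces of the induced subgraph *)

Section SphericalEigenvectors.
Variables (R : rcfType) (n r1 r2 : nat).
Hypotheses (r2n : (2 * r2 <= n)%N) (r12 : (r1 < r2)%N).
Implicit Types (t i : nat) (u v h : {set 'I_n} -> R) (c : nat -> R) (w x y z : {set 'I_n}).

Local Notation B := (Bset n r1 r2).
Local Notation A := (adjA R n r1 r2).

Lemma fvec_adjA (f : 'rV[R]_#|B|) y : y \in B ->
  fvec (f *m A) y
  = \sum_(a in y) fvec f (y :\ a) + \sum_(a | a \notin y) fvec f (a |: y).
Proof.
move=> yB; rewrite (_ : A = opmx B B (fun x y => (cube_adj x y)%:R)); last first.
  by apply/matrixP => i j; rewrite !mxE.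
rewrite fvec_opmx // -sum_cube_adj big_mkcond; apply: eq_bigr => x _.
by case: ifPn => xB; rewrite ?(fvec_out _ xB) ?mulr0 1?mulrC.
Qed.

Lemma adjA_sym : A^T = A.
Proof. by apply/matrixP => i j; rewrite !mxE /cube_adj setUC. Qed.

(** The residual of the radial recurrence, taken pointwise on the [t]-subsets; it is the coefficient
    function of [lambda *: f - f *m A] in degree [t]. *)
Definition defect t (lambda : R) (v : nat -> {set 'I_n} -> R) i z : R :=
  lambda * v i z - ((i%:R - t%:R) * v i.-1 z + (n%:R - i%:R - t%:R) * v i.+1 z).

Lemma harmonic_defect t lambda (v : nat -> {set 'I_n} -> R) i : (forall i, harmonic t (v i)) ->
  harmonic t (defect t lambda v i).
Proof.
move=> hv w wt; rewrite /defect sumrB big_split /= -!mulr_sumr !hv // !mulr0.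
by rewrite addr0 subrr.
Qed.

(** Since [v i] is 0 outside the levels of [B], neighbours that leave [B] contribute nothing and the
    full up and down formulas apply. *)
Lemma fvec_defect t lambda (v : nat -> {set 'I_n} -> R) (f : 'rV[R]_#|B|) :
  (forall i, harmonic t (v i)) ->
  (forall i z, ~~ (r1 <= i <= r2)%N -> v i z = 0) ->
  (forall y, y \in B -> fvec f y = incl_sum t (v #|y|) y) ->
  forall y, y \in B -> fvec (lambda *: f - f *m A) y = incl_sum t (defect t lambda v #|y|) y.
Proof.
move=> hv v0 fv y yB.
have fv' x : fvec f x = incl_sum t (v #|x|) x.
  case: (boolP (x \in B)) => [/fv //|xB]; rewrite (fvec_out _ xB).
  by rewrite inE in xB; rewrite /incl_sum big1 // => z _; rewrite v0.
rewrite fvecB fvecZ fvec_adjA // fv //.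
under [X in _ - (X + _)]eq_bigr => a ay.
  have -> : fvec f (y :\ a) = incl_sum t (v #|y|.-1) (y :\ a).
    by rewrite fv' (cardsD1 a y) ay.
  over.
under [X in _ - (_ + X)]eq_bigr => a ay.
  have -> : fvec f (a |: y) = incl_sum t (v #|y|.+1) (a |: y).
    by rewrite fv' cardsU1 ay.
  over.
rewrite incl_sum_up incl_sum_down // -!incl_sumZ /incl_sum -big_split -sumrB.
by apply: eq_bigr.
Qed.

(** For a normalised radial solution [c] this is the space [W_t(lambda)]; [<<_>>] turns the
    generators into a square matrix. *)
Definition Wmx t c : 'M[R]_#|B| :=
  <<(kermx (downmx R n t) *m
     opmx (level n t) B (fun z y => c #|y| * (z \subset y)%:R))%R>>%MS.

Lemma fvec_Wopmx t c (r : 'rV[R]_#|level n t|) y : y \in B ->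
  fvec (r *m opmx (level n t) B (fun z y => c #|y| * (z \subset y)%:R)) y
  = c #|y| * incl_sum t (fvec r) y.
Proof.
move=> yB; rewrite fvec_opmx // /incl_sum big_mkcondr mulr_sumr.
apply: eq_big => z; first by rewrite inE.
by case: (z \subset y); rewrite ?mulr1 ?mulr0 // mulrC.
Qed.

Lemma WmxP t c (f : 'rV[R]_#|B|) :
  (f <= Wmx t c)%MS <-> exists2 v, harmonic t v &
     forall y, y \in B -> fvec f y = c #|y| * incl_sum t v y.
Proof.
rewrite /Wmx genmxE; split.
  case/submxP => r ->; exists (fvec (r *m kermx (downmx R n t))).
    by apply/harmonicP; rewrite -mulmxA mulmx_ker mulmx0.
  by move=> y yB; rewrite mulmxA fvec_Wopmx.
case=> v hv fv; pose r := rvec (level n t) v.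
have rv z : #|z| = t -> v z = fvec r z by move=> zt; rewrite fvec_rvec ?inE ?zt.
have : (r <= kermx (downmx R n t))%MS.
  by apply/sub_kermxP/harmonicP; apply: eq_harmonic hv.
move/(submxMr (opmx (level n t) B (fun z y => c #|y| * (z \subset y)%:R))).
congr (_ <= _)%MS; apply: fvec_inj => y yB.
by rewrite fvec_Wopmx // fv // (eq_incl_sum _ rv).
Qed.

Lemma Bset_level i x : (r1 <= i <= r2)%N -> #|x| = i -> x \in B.
Proof. by move=> Hi xi; rewrite inE xi. Qed.

Lemma harmonic_eq0 t i v : (t <= i <= r2)%N -> harmonic t v ->
  (forall x, #|x| = i -> incl_sum t v x = 0) -> forall z, #|z| = t -> v z = 0.
Proof. by move=> /andP[ti ir] hv; apply: incl_sum_inj => //; lia. Qed.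

Lemma Wmx_eq0 t c (f : 'rV[R]_#|B|) : (t <= r2)%N -> c (maxn t r1) = 1 ->
  (f <= Wmx t c)%MS -> (forall x, #|x| = maxn t r1 -> fvec f x = 0) -> f = 0.
Proof.
move=> tr cs /WmxP[v hv fv] f0; apply: fvec_inj => y yB; rewrite fvec0 fv //.
rewrite /incl_sum big1 ?mulr0 // => z /andP[/eqP zt _].
apply: (@harmonic_eq0 t (maxn t r1)) => // [|x xs]; first by lia.
by have := f0 x xs; rewrite fv ?xs ?cs ?mul1r //; apply: (Bset_level _ xs); lia.
Qed.

Lemma rank_Wmx t c : (t <= r2)%N -> c (maxn t r1) = 1 -> \rank (Wmx t c) = dimV n t.
Proof.
move=> tr cs; rewrite mxrank_gen -(@rank_harmonic R n t); last by lia.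
apply/mxrank_injP/eqP/eqP/rowV0P => r; rewrite sub_capmx => /andP[/sub_kermxP/harmonicP hr /sub_kermxP r0].
apply: fvec_inj => z; rewrite inE fvec0 => /eqP zt.
apply: (@harmonic_eq0 t (maxn t r1) (fvec r)) => // [|x xs]; first by lia.
have := fvec_Wopmx c r (y := x); rewrite r0 fvec0 xs cs mul1r => <- //.
by apply: (Bset_level _ xs); lia.
Qed.

Lemma Wmx_eigen t c lambda : (t <= r2)%N -> radial_sol n r1 r2 t lambda c ->
  (Wmx t c <= eigenspace A lambda)%MS.
Proof.
move=> tr [c0 Ec]; apply/rV_subP => f /WmxP[v hv fv]; apply/eigenspaceP.
apply/esym/eqP; rewrite -subr_eq0; apply/eqP/fvec_inj => y yB.
pose V i z := c i * v z.
rewrite fvec0 (@fvec_defect t lambda V) // => [|i|i z Hi|x xB]; last 1 first.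
- by rewrite fv // incl_sumZ.
(* Points of [B] below level [t] have an empty inclusion sum; all others lie on levels where the
   recurrence holds. *)
- case: (ltnP #|y| t) => [yt|ty]; first exact: incl_sum_small.
  rewrite /incl_sum big1 // => z _; rewrite /defect /V.
  move: yB; rewrite inE => yB.
  have Hy : (maxn t r1 <= #|y| <= r2)%N by lia.
  by rewrite mulrA Ec //; ring.
- exact: harmonicZ.
- by rewrite /V c0 ?mul0r //; lia.
Qed.

Lemma Wmx_dot t s c d i (f g : 'rV[R]_#|B|) : (f <= Wmx t c)%MS -> (g <= Wmx s d)%MS ->
  s != t -> dot i (fvec f) (fvec g) = 0.
Proof.
move=> /WmxP[v hv fv] /WmxP[u hu gu] st.
case: (boolP (r1 <= i <= r2)%N) => Hi; last first.
  apply: big1 => x; rewrite inE => /eqP xi.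
  by rewrite (fvec_out f) ?mul0r // inE xi.
rewrite (eq_dot (f' := incl_sum t (fun z => c i * v z)) (g' := incl_sum s (fun z => d i * u z))).
- by apply: incl_sum_orth_neq => //; apply: harmonicZ.
- by move=> x xi; rewrite fv ?incl_sumZ ?xi //; apply: Bset_level xi.
- by move=> x xi; rewrite gu ?incl_sumZ ?xi //; apply: Bset_level xi.
Qed.

(** The rest [d] of [h] after removing its degree [t] component is orthogonal to every degree [s]
    component with [s != t]: for [s < t] since [h] is orthogonal to [U_(t-1)], for [s > t] since [h]
    is in [U_t]. So [d] is orthogonal to itself. *)
Lemma inV_harmonic t i h : (t <= i)%N -> inV i t h ->
  exists2 v, harmonic t v & forall x, #|x| = i -> h x = incl_sum t v x.
Proof.
move=> ti [[cz Eh] oh]; have [v [hv Ev]] := harmonic_decomp i h.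
have {}oh z : (#|z| < t)%N -> \sum_(x in level n i) h x * gz R z x = 0.
  move=> zt; have zi : (#|z| <= i)%N by apply: leq_trans ti; exact: ltnW.
  by move: oh zt; case: (t) => // t' oh zt; apply: oh.
exists (v t) => //.
pose d x := h x - incl_sum t (v t) x.
have dE x : #|x| = i -> d x = \sum_(s < i.+1 | s != t :> nat) incl_sum s (v s) x.
  have ti' : (t < i.+1)%N by [].
  by move=> xi; rewrite /d Ev // (bigD1 (Ordinal ti')) //= addrAC subrr add0r.
suff dd : dot i d d = 0.
  by move=> x xi; apply/eqP; rewrite -subr_eq0; apply/eqP; apply: (dot_eq0 dd xi).
rewrite (eq_dot (f' := d) (fun _ _ => erefl) dE) dot_sumr big1 // => s st.
have -> : dot i d (incl_sum s (v s)) =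
    dot i h (incl_sum s (v s)) - dot i (incl_sum t (v t)) (incl_sum s (v s)).
  by rewrite /dot -sumrB; apply: eq_bigr => x _; rewrite mulrBl.
rewrite incl_sum_orth_neq // subr0; move: st; rewrite neq_ltn => /orP[st|ts].
  rewrite /dot; under eq_bigr do rewrite incl_sum_gz mulr_sumr.
  rewrite exchange_big big1 //= => z /eqP zs.
  under eq_bigr do rewrite mulrCA.
  by rewrite -mulr_sumr oh ?mulr0 // zs.
rewrite dotC /dot; under eq_bigr => x xi do rewrite Eh // mulr_sumr.
rewrite exchange_big big1 //= => z /andP[zt _].
under eq_bigr do rewrite mulrCA.
by rewrite -mulr_sumr incl_sum_orth_gz ?mulr0 //; apply: leq_ltn_trans ts.
Qed.

Lemma Wmx_inV t c (f : 'rV[R]_#|B|) i : (f <= Wmx t c)%MS -> (maxn t r1 <= i <= r2)%N ->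
  inV i t (fvec f).
Proof.
move=> /WmxP[v hv fv] Hi; have {}fv x : x \in level n i -> fvec f x = c i * incl_sum t v x.
  by rewrite inE => /eqP xi; rewrite fv ?xi //; apply: (Bset_level _ xi); lia.
split.
  exists (fun z => if #|z| == t then c i * v z else 0) => x xi; rewrite fv //.
  rewrite incl_sum_gz mulr_sumr [LHS]big_mkcond [RHS]big_mkcond.
  apply: eq_bigr => z _; case: eqP => [->|_]; last by rewrite mul0r if_same.
  by rewrite ifT ?mulrA //; lia.
case: t hv fv Hi => // t hv fv Hi z zt zi.
under eq_bigr => x xi do rewrite fv // -mulrA.
by rewrite -mulr_sumr incl_sum_orth_gz ?mulr0.
Qed.

(** * Splitting an eigenspace of [A] by degree *)

Section Decomposition.
Variables (lambda : R) (c : 'I_r2.+1 -> nat -> R).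
Hypothesis solc : forall t : 'I_r2.+1, eigenvalue (Mt R n r1 r2 t) lambda ->
  radial_sol n r1 r2 t lambda (c t) /\ c t (maxn t r1) = 1.

Local Notation Lam t := (eigenvalue (Mt R n r1 r2 t) lambda).

(** For each fixed [t]-subset [z], the sequence [v i z] in [i] is a radial solution. It is thus a
    multiple of [c t], or zero when [lambda] is not an eigenvalue of [Mt]. *)
Lemma radial_component (t : 'I_r2.+1) (v : nat -> {set 'I_n} -> R) (f : 'rV[R]_#|B|) :
  (forall i, harmonic t (v i)) ->
  (forall i z, ~~ (maxn t r1 <= i <= r2)%N -> v i z = 0) ->
  (forall i z, (maxn t r1 <= i <= r2)%N -> #|z| = t -> defect t lambda v i z = 0) ->
  (forall y, y \in B -> fvec f y = incl_sum t (v #|y|) y) ->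
  if Lam t then is_true (f <= Wmx t (c t))%MS else f = 0.
Proof.
move=> hv v0 dv fv; have tr : (t <= r2)%N by rewrite -ltnS.
have sol z : #|z| = t -> radial_sol n r1 r2 t lambda (fun i => v i z).
  move=> zt; split=> i Hi; first exact: v0.
  by apply/eqP; rewrite -subr_eq0; apply/eqP; exact: (dv i z Hi zt).
case: (boolP (Lam t)) => Lt.
  have [sc cs] := solc Lt.
  apply/WmxP; exists (v (maxn t r1)) => // y yB.
  rewrite fv // -incl_sumZ; apply: eq_incl_sum => z zt.
  exact: (radial_sol_unique r2n r12 tr sc (sol z zt) cs).
apply: fvec_inj => y yB; rewrite fvec0 fv // /incl_sum big1 // => z /andP[/eqP zt _].
apply: (radial_sol0 r2n r12 tr (sol z zt)).
apply/eqP; apply: contraNT Lt => vn0; apply/(eigenvalue_MtP lambda r2n r12 tr).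
exists (fun i => (v (maxn t r1) z)^-1 * v i z + 0 * v i z).
  by apply: radial_sol_comb; apply: sol.
by rewrite mulVf // mul0r addr0.
Qed.

Lemma eigenspace_sub_sum :
  (eigenspace A lambda <= \sum_(t < r2.+1 | Lam t) Wmx t (c t))%MS.
Proof.
apply/rV_subP => f /eigenspaceP fA.
have [V HV] := fin_all_exists (fun i : 'I_r2.+1 => harmonic_decomp i (fvec f)).
(* The cut at [maxn t r1] loses nothing, as inclusion sums are empty for [i < t], and it gives the
   support of a radial solution; under the guard [inord i] is [i]. *)
pose v t i z := if (maxn t r1 <= i <= r2)%N then V (inord i : 'I_r2.+1) t z else 0.
have hv t i : harmonic t (v t i).
  rewrite /v; case: (maxn t r1 <= i <= r2)%N => w wt; last exact: big1.
  by have [hV _] := HV (inord i : 'I_r2.+1); apply: hV.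
have v0 t i z : ~~ (maxn t r1 <= i <= r2)%N -> v t i z = 0.
  by rewrite /v => /negPf ->.
pose F (t : 'I_r2.+1) := rvec B (fun y => incl_sum t (v t #|y|) y).
have FE (t : 'I_r2.+1) y : y \in B -> fvec (F t) y = incl_sum t (v t #|y|) y by exact: fvec_rvec.
have fF : f = \sum_t F t.
  apply: fvec_inj => y yB; rewrite fvec_sum; under eq_bigr do rewrite FE //.
  have := yB; rewrite inE => Hy; have yr : (#|y| < r2.+1)%N by lia.
  have [_ ->] := HV (Ordinal yr); last by [].
  rewrite (big_ord_widen _ (fun t => incl_sum t (V (Ordinal yr) t) y) yr) /=.
  rewrite big_mkcond; apply: eq_bigr => t _; case: ifPn => [ty|]; last first.
    by rewrite -ltnNge => ty; rewrite incl_sum_small.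
  apply: eq_incl_sum => z _; rewrite /v ifT; last by rewrite geq_max -[(t <= _)%N]ltnS ty.
  by congr (V _ t z); apply: val_inj; rewrite /= inordK.
have v0' (t : 'I_r2.+1) i z : ~~ (r1 <= i <= r2)%N -> v t i z = 0.
  by move=> Hi; apply: v0; lia.
have dF (t : 'I_r2.+1) y := fvec_defect lambda (hv t) (@v0' t) (FE t) (y := y).
have dsum : \sum_t (lambda *: F t - F t *m A) = 0.
  by rewrite sumrB -scaler_sumr -mulmx_suml -fF fA subrr.
(* Orthogonality of distinct degrees on level [i] splits the single equation [dsum] by degree;
   injectivity of the inclusion sum then kills the defect itself. *)
have d0 (s : 'I_r2.+1) i z : (maxn s r1 <= i <= r2)%N -> #|z| = s ->
    defect s lambda (v s) i z = 0.
  move=> Hi; apply: (@harmonic_eq0 s i); [lia | exact: harmonic_defect |].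
  have iB : (r1 <= i <= r2)%N by lia.
  apply: dot_eq0; pose e (t : 'I_r2.+1) := incl_sum t (defect t lambda (v t) i).
  rewrite -/(e s); transitivity (dot i (e s) (fun x => \sum_t e t x)); last first.
    apply: big1 => x; rewrite inE => /eqP xi; rewrite (_ : \sum_t _ = 0) ?mulr0 //.
    rewrite -[RHS](fvec0 R B x) -dsum fvec_sum; apply: eq_bigr => t _.
    by rewrite dF ?xi //; apply: Bset_level xi.
  rewrite dot_sumr (bigD1 s) //= big1 ?addr0 // => t ts.
  by apply: incl_sum_orth_neq => //; apply: harmonic_defect.
rewrite fF big_mkcond /=; apply: summx_sub => t _.
have := radial_component (hv t) (v0 t) (d0 t) (FE t).
case: ifP => Lt; last by move=> ->; exact: sub0mx.
by move=> Ft; rewrite (sumsmx_sup t).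
Qed.

(** A vector of one [Wmx] lying in the sum of the others is orthogonal to itself on every level. *)
Lemma mxdirect_Wmx : mxdirect (\sum_(t < r2.+1 | Lam t) Wmx t (c t)).
Proof.
apply/mxdirect_sumsP => t Lt; apply/eqP/rowV0P => f; rewrite sub_capmx => /andP[ft].
case/sub_sumsmxP => u fu; apply: fvec_inj => y _; rewrite fvec0.
apply: (@dot_eq0 _ _ #|y| (fvec f)) => //.
rewrite {2}fu (eq_dot (f' := fvec f) (g' := fun x =>
  \sum_(s < r2.+1 | Lam s && (s != t)) fvec (u s *m Wmx s (c s)) x)) //; last first.
  by move=> x _; exact: fvec_sum.
by rewrite dot_sumr big1 // => s /andP[_ st]; apply: Wmx_dot ft (submxMl _ _) _.
Qed.

Lemma rank_eigenspace : \rank (eigenspace A lambda) = (\sum_(t < r2.+1 | Lam t) dimV n t)%N.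
Proof.
have le t : (t < r2.+1)%N -> (t <= r2)%N by [].
have -> : \rank (eigenspace A lambda) = \rank (\sum_(t < r2.+1 | Lam t) Wmx t (c t))%MS.
  apply/eqP; rewrite (mxrank_leqif_sup eigenspace_sub_sum); apply/sumsmx_subP => t /solc[sc _].
  exact: Wmx_eigen (le t _) sc.
rewrite (mxdirectP mxdirect_Wmx) /=; apply: eq_bigr => t /solc[_ cs].
exact: rank_Wmx (le t _) cs.
Qed.

End Decomposition.

End SphericalEigenvectors.

Theorem theorem1p10 (R : rcfType) (n r1 r2 : nat) :
  (r1 < r2)%N -> (2 * r2 <= n)%N ->
  let A := adjA R n r1 r2 in
  (* (1) and (2) *)
  (forall t : nat, (t <= r2)%N ->
   forall lambda : R, eigenvalue (Mt R n r1 r2 t) lambda ->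
   exists W : 'M[R]_#|Bset n r1 r2|,
     [/\ (W <= eigenspace A lambda)%MS,
         \rank W = dimV n t,
         forall f : 'rV[R]_#|Bset n r1 r2|, (f <= W)%MS ->
           (forall i, (maxn t r1 <= i <= r2)%N -> inV i t (vfun f)) /\
           (forall x, x \in Bset n r1 r2 -> (#|x| < maxn t r1)%N -> vfun f x = 0),
         forall h : {set 'I_n} -> R, inV (maxn t r1) t h ->
           exists2 f : 'rV[R]_#|Bset n r1 r2|, (f <= W)%MS &
             forall x, x \in level n (maxn t r1) -> vfun f x = h x
       & forall f g : 'rV[R]_#|Bset n r1 r2|, (f <= W)%MS -> (g <= W)%MS ->
           (forall x, x \in level n (maxn t r1) -> vfun f x = vfun g x) -> f = g])
  /\
  (* (3) *)
  (forall lambda : R,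
     eigenvalue A lambda <->
     exists2 t : nat, (t <= r2)%N & eigenvalue (Mt R n r1 r2 t) lambda)
  /\
  (forall lambda : R, eigenvalue A lambda ->
     mup lambda (char_poly A) =
     (\sum_(t < r2.+1 | eigenvalue (Mt R n r1 r2 t) lambda) dimV n t)%N).
Proof.
move=> r12 r2n A.
have solW t lambda : (t <= r2)%N -> eigenvalue (Mt R n r1 r2 t) lambda ->
    exists c, radial_sol n r1 r2 t lambda c /\ c (maxn t r1) = 1.
  by move=> tr /(eigenvalue_MtP lambda r2n r12 tr)[c sc cs]; exists c.
have rankE lambda : \rank (eigenspace A lambda) =
    (\sum_(t < r2.+1 | eigenvalue (Mt R n r1 r2 t) lambda) dimV n t)%N.
  (* Choosing [c] for all [t] at once needs a value also where [lambda] is not an eigenvalue; the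
     zero sequence serves there. *)
  have H (t : 'I_r2.+1) : exists c, eigenvalue (Mt R n r1 r2 t) lambda ->
      radial_sol n r1 r2 t lambda c /\ c (maxn t r1) = 1.
    case: (boolP (eigenvalue _ _)) => Lt; last by exists (fun=> 0).
    by have [c Hc] := solW t lambda (ltnSE (ltn_ord t)) Lt; exists c.
  by have [c solc] := fin_all_exists H; exact: rank_eigenspace solc.
split; [|split].
- move=> t tr lambda /(solW t lambda tr)[c [sc cs]]; exists (Wmx n r1 r2 t c).
  have sr : (r1 <= maxn t r1 <= r2)%N by lia.
  split; [exact: Wmx_eigen | exact: rank_Wmx | | |].
  + move=> f fW; split=> [i Hi|x xB xs]; first exact: Wmx_inV fW Hi.
    have /WmxP[v _ fv] := fW; rewrite -[LHS]/(fvec f x) fv //.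
    by rewrite (proj1 sc) ?mul0r //; lia.
  + move=> h hV; have [v hv hE] := inV_harmonic (leq_maxl _ _) hV.
    (* The harmonic [v] representing [h] on the bottom level is carried to the other levels by [c],
       which is 1 at the bottom. *)
    exists (rvec _ (fun y : {set 'I_n} => c #|y| * incl_sum t v y)).
      by apply/WmxP; exists v => // y yB; rewrite fvec_rvec.
    move=> x; rewrite inE => /eqP xs.
    by rewrite -[LHS]/(fvec _ x) fvec_rvec ?(Bset_level sr xs) // xs cs mul1r hE.
  + move=> f g fW gW fg; apply/eqP; rewrite -subr_eq0; apply/eqP.
    apply: (Wmx_eq0 r2n r12 tr cs) => [|x xs]; first by rewrite addmx_sub ?eqmx_opp.
    by rewrite fvecB [fvec f x](fg x) ?subrr // inE xs.
- move=> lambda; split=> [|[t tr Lt]]; last first.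
    have tr' : (t < r2.+1)%N by [].
    rewrite /eigenvalue -mxrank_eq0 rankE -lt0n (bigD1 (Ordinal tr')) //=.
    by rewrite addn_gt0 dimV_gt0 //; lia.
  rewrite /eigenvalue -mxrank_eq0 rankE sum_nat_eq0 negb_forall => /existsP[t].
  by rewrite negb_imply => /andP[Lt _]; exists t => //; rewrite -ltnS.
- by move=> lambda _; rewrite mup_char_poly_sym ?rankE //; exact: adjA_sym.
Qed.
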